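(* Let $M$ be a $2n$-manifold with an $SU(n)$-structure, $n\ge2$. Under conformal changes of metric $\langle\cdot,\cdot\rangle_o=e^{2f}\langle\cdot,\cdot\rangle$, the $\mathcal W_4$ and $\mathcal W_5$ parts of the intrinsic $SU(n)$-torsion are modified by $$I\,d^*\omega_o=I\,d^*\omega-2(n-1)\,df,\qquad \eta_o=\eta-\frac1n\,df,$$ where $\omega_o$ and $\eta_o$ are respectively the Kähler form and the $\mathcal W_5$ one-form of the metric $\langle\cdot,\cdot\rangle_o$ (and on the left-hand side $d^*$ is taken with respect to $\langle\cdot,\cdot\rangle_o$). Moreover, the one-form $2n(n-1)\eta-I\,d^*\omega$ is not altered by such changes of metric.
   Context: An $SU(n)$-structure (special almost Hermitian structure) on a $2n$-manifold $M$ consists of a Riemannian metric $\langle\cdot,\cdot\rangle$, an orthogonal almost complex structure $I$, and a complex volume form $\Psi=\psi_++i\psi_-$ of unit length; vectors are identified with one-forms by $x\mapsto\langle\cdot,x\rangle$, and locally there are orthonormal (adapted) frames $e_1,\dots,e_n,Ie_1,\dots,Ie_n$ with $\Psi=(e_1+iIe_1)\wedge\dots\wedge(e_n+iIe_n)$. Kähler form: $\omega(x,y)=\langle x,Iy\rangle$. For a one-form $\mu$, $(I\mu)(X)=-\mu(IX)$. The coderivative is $d^*b=-\sum_i(\nabla_{e_i}b)(e_i,\cdot,\dots)$, with $\nabla$ the Levi-Civita connection. The intrinsic torsion is $\eta+\xi$, where $\overline\nabla=\nabla+\eta+\xi$ is the minimal $SU(n)$-connection (preserving the metric, $\omega$,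 $\psi_\pm$), with $\xi_XY=-\frac12I(\nabla_XI)Y$ and $\eta_XY=(I\eta)(X)\,IY$ for a one-form denoted by the same letter $\eta$, the $\mathcal W_5$ one-form; the $\mathcal W_4$-part is determined by the one-form $I\,d^*\omega$. For a smooth function $f$, the conformally changed $SU(n)$-structure has metric $\langle\cdot,\cdot\rangle_o=e^{2f}\langle\cdot,\cdot\rangle$, the same $I$, Kähler form $\omega_o=e^{2f}\omega$ and complex volume form with $\psi_{+o}=e^{nf}\psi_+$, $\psi_{-o}=e^{nf}\psi_-$. *)

(* Defs.v *)
From HB Require Import structures.
From mathcomp Require Import all_boot all_order all_algebra.
From mathcomp Require Import complex.
From mathcomp Require Import all_classical all_reals all_analysis.

Set Implicit Arguments.
Unset Strict Implicit.
Unset Printing Implicit Defensive.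

Import Order.TTheory GRing.Theory Num.Theory.
Import numFieldNormedType.Exports.

Local Open Scope classical_set_scope.
Local Open Scope ring_scope.

(* ['D_v1 ('D_v2 (... f))] for [vs = [:: v1; v2; ...]]. *)
Fixpoint iter_derive (R : realType) (m : nat) (f : 'rV[R]_m -> R)
    (vs : seq 'rV[R]_m) : 'rV[R]_m -> R :=
  if vs is v :: vs' then fun x => 'D_v (iter_derive f vs') x else f.

(* C^oo on the open set [U]: all iterated directional derivatives exist and are
   continuous at every point of [U]. *)
Definition smooth_on (R : realType) (m : nat) (U : set 'rV[R]_m)
    (f : 'rV[R]_m -> R) : Prop :=
  forall (vs : seq 'rV[R]_m) (x : 'rV[R]_m), U x ->
    {for x, continuous (iter_derive f vs)} /\
    forall v, derivable (iter_derive f vs) x v.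

Definition smooth_map_on (R : realType) (m : nat) (U : set 'rV[R]_m)
    (F : 'rV[R]_m -> 'rV[R]_m) : Prop :=
  forall j, smooth_on U (fun x => F x ord0 j).

(* The charts of the atlas are indexed by [chart]; [cmap c] is meaningful on
   [cdom c], and [cinv c] on the image of [cdom c] under [cmap c]. *)
Record manifold (R : realType) (m : nat) := Manifold {
  carrier :> topologicalType;
  carrier_hausdorff : hausdorff_space carrier;
  carrier_countable : @second_countable carrier;
  chart : Type;
  cdom : chart -> set carrier;
  cmap : chart -> carrier -> 'rV[R]_m;
  cinv : chart -> 'rV[R]_m -> carrier;
  chart_cover : forall p, exists c, cdom c p;
  cdom_open : forall c, open (cdom c);
  cimg_open : forall c, open (cmap c @` cdom c);
  cmapK : forall c p, cdom c p -> cinv c (cmap c p) = p;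
  cmap_continuous : forall c, {within cdom c, continuous (cmap c)};
  cinv_continuous : forall c, {within cmap c @` cdom c, continuous (cinv c)};
  transition_smooth : forall c d,
    smooth_map_on (cmap c @` (cdom c `&` cdom d)) (fun x => cmap d (cinv c x))
}.

Definition cimg (R : realType) (m : nat) (M : manifold R m) (c : chart M) :
  set 'rV[R]_m := cmap c @` cdom c.

Definition overlap (R : realType) (m : nat) (M : manifold R m)
    (c d : chart M) : set 'rV[R]_m := cmap c @` (cdom c `&` cdom d).

Definition transition (R : realType) (m : nat) (M : manifold R m)
    (c d : chart M) (x : 'rV[R]_m) : 'rV[R]_m := cmap d (cinv c x).

Definition smooth_function (R : realType) (m : nat) (M : manifold R m)
    (f : M -> R) : Prop :=
  forall c : chart M, smooth_on (cimg c) (fun x => f (cinv c x)).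

(* A covariant k-tensor field is given by its expression in every chart: a
   function of a point of the image of the chart and of k tangent vectors
   written in the coordinate frame.  Values off the image are irrelevant. *)
Definition tensor (R : realType) (m : nat) (M : manifold R m) (k : nat) : Type :=
  chart M -> 'rV[R]_m -> ('I_k -> 'rV[R]_m) -> R.

Definition endo (R : realType) (m : nat) (M : manifold R m) : Type :=
  chart M -> 'rV[R]_m -> 'rV[R]_m -> 'rV[R]_m.

Definition upd (T : Type) (k : nat) (v : 'I_k -> T) (i : 'I_k) (u : T) :
  'I_k -> T := fun j => if j == i then u else v j.

Definition pair_arg (T : Type) (u v : T) : 'I_2 -> T :=
  fun i => if i == ord0 then u else v.

Definition is_tensor (R : realType) (m : nat) (M : manifold R m) (k : nat)
    (T : tensor M k) : Prop :=
  [/\ forall (c : chart M) x, cimg c x -> forall v i (a : R) u w,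
        T c x (upd v i (a *: u + w)) = a * T c x (upd v i u) + T c x (upd v i w),
      forall (c : chart M) v, smooth_on (cimg c) (fun x => T c x v)
    & forall (c d : chart M) x, overlap c d x -> forall v,
        T c x v = T d (transition c d x) (fun i => 'D_(v i) (transition c d) x)].

Definition is_endo (R : realType) (m : nat) (M : manifold R m)
    (A : endo M) : Prop :=
  [/\ forall (c : chart M) x, cimg c x -> forall (a : R) u w,
        A c x (a *: u + w) = a *: A c x u + A c x w,
      forall (c : chart M) v, smooth_map_on (cimg c) (fun x => A c x v)
    & forall (c d : chart M) x, overlap c d x -> forall v,
        'D_(A c x v) (transition c d) x
        = A d (transition c d x) ('D_v (transition c d) x)].

Definition differential (R : realType) (m : nat) (M : manifold R m)
    (f : M -> R) : tensor M 1 :=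
  fun c x v => 'D_(v ord0) (fun y => f (cinv c y)) x.

(* [D c x u v] is the covariant derivative in the direction [u] of the field
   with constant coordinates [v], that is [Gamma^k_ij u^i v^j]. *)
Definition connection (R : realType) (m : nat) (M : manifold R m) : Type :=
  chart M -> 'rV[R]_m -> 'rV[R]_m -> 'rV[R]_m -> 'rV[R]_m.

Definition is_connection (R : realType) (m : nat) (M : manifold R m)
    (D : connection M) : Prop :=
  [/\ forall (c : chart M) x, cimg c x -> forall (a : R) u u' v,
        D c x (a *: u + u') v = a *: D c x u v + D c x u' v,
      forall (c : chart M) x, cimg c x -> forall (a : R) u v v',
        D c x u (a *: v + v') = a *: D c x u v + D c x u v',
      forall (c : chart M) u v, smooth_map_on (cimg c) (fun x => D c x u v)
    & forall (c d : chart M) x, overlap c d x -> forall u v,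
        'D_(D c x u v) (transition c d) x
        = 'D_u (fun y => 'D_v (transition c d) y) x
          + D d (transition c d x) ('D_u (transition c d) x)
              ('D_v (transition c d) x)].

(* [(nabla_u T)(v_1, ..., v_k)] *)
Definition cov_tensor (R : realType) (m : nat) (M : manifold R m)
    (D : connection M) (k : nat) (T : tensor M k)
    (c : chart M) (x u : 'rV[R]_m) (v : 'I_k -> 'rV[R]_m) : R :=
  'D_u (fun y => T c y v) x - \sum_(i < k) T c x (upd v i (D c x u (v i))).

(* [(nabla_u A) v = nabla_u (A v) - A (nabla_u v)] *)
Definition cov_endo (R : realType) (m : nat) (M : manifold R m)
    (D : connection M) (A : endo M) (c : chart M) (x u v : 'rV[R]_m) :
    'rV[R]_m :=
  'D_u (fun y => A c y v) x + D c x u (A c x v) - A c x (D c x u v).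

Definition parallel (R : realType) (m : nat) (M : manifold R m)
    (D : connection M) (k : nat) (T : tensor M k) : Prop :=
  forall (c : chart M) x, cimg c x -> forall u v, cov_tensor D T c x u v = 0.

Definition torsion_free (R : realType) (m : nat) (M : manifold R m)
    (D : connection M) : Prop :=
  forall (c : chart M) x, cimg c x -> forall u v, D c x u v = D c x v u.

Definition is_metric (R : realType) (m : nat) (M : manifold R m)
    (g : tensor M 2) : Prop :=
  [/\ is_tensor g,
      forall (c : chart M) x, cimg c x -> forall u v,
        g c x (pair_arg u v) = g c x (pair_arg v u)
    & forall (c : chart M) x, cimg c x -> forall u,
        u != 0 -> 0 < g c x (pair_arg u u)].

Definition levi_civita (R : realType) (m : nat) (M : manifold R m)
    (g : tensor M 2) (D : connection M) : Prop :=
  [/\ is_connection D, torsion_free D & parallel D g].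

(* A choice of m tangent vectors at each point, in each chart; neither
   continuity nor compatibility between charts is required. *)
Definition frame_choice (R : realType) (m : nat) (M : manifold R m) : Type :=
  chart M -> 'rV[R]_m -> 'I_m -> 'rV[R]_m.

Definition orthonormal_frame (R : realType) (m : nat) (M : manifold R m)
    (g : tensor M 2) (e : frame_choice M) : Prop :=
  forall (c : chart M) x, cimg c x -> forall i j,
    g c x (pair_arg (e c x i) (e c x j)) = (i == j)%:R.

(* [d^* b = - sum_i (nabla_{e_i} b)(e_i, .)] for a 2-form [b]; [D] and [e] are
   meant to be the Levi-Civita connection and an orthonormal frame of the metric
   in use. *)
Definition coderivative (R : realType) (m : nat) (M : manifold R m)
    (D : connection M) (e : frame_choice M) (b : tensor M 2) : tensor M 1 :=
  fun c x v =>
    - \sum_(i < m) cov_tensor D b c x (e c x i) (pair_arg (e c x i) (v ord0)).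

Record su_data (R : realType) (n : nat) (M : manifold R (2 * n)) := SUData {
  met : tensor M 2;
  acs : endo M;
  psi_re : tensor M n;
  psi_im : tensor M n
}.

(* [e_1, ..., e_n, I e_1, ..., I e_n] is orthonormal at [x], and
   [Psi = (e_1 + i I e_1) /\ ... /\ (e_n + i I e_n)] there, vectors being
   identified with one-forms by the metric.  The wedge product of one-forms
   [t_1, ..., t_n] takes the value [det (t_k (v_l))] on [v_1, ..., v_n]. *)
Definition adapted (R : realType) (n : nat) (M : manifold R (2 * n))
    (S : su_data M) (c : chart M) (x : 'rV[R]_(2 * n))
    (e : 'I_n -> 'rV[R]_(2 * n)) : Prop :=
  let ip u v := met S c x (pair_arg u v) in
  let I := acs S c x in
  [/\ forall i j, ip (e i) (e j) = (i == j)%:R,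
      forall i j, ip (e i) (I (e j)) = 0,
      forall i j, ip (I (e i)) (I (e j)) = (i == j)%:R
    & forall v : 'I_n -> 'rV[R]_(2 * n),
        (psi_re S c x v +i* psi_im S c x v)%C
        = \det (\matrix_(k < n, l < n)
                  (ip (e k) (v l) +i* ip (I (e k)) (v l))%C)].

Definition is_su_structure (R : realType) (n : nat) (M : manifold R (2 * n))
    (S : su_data M) : Prop :=
  [/\ is_metric (met S),
      [/\ is_endo (acs S),
          forall (c : chart M) x, cimg c x -> forall u,
            acs S c x (acs S c x u) = - u
        & forall (c : chart M) x, cimg c x -> forall u v,
            met S c x (pair_arg (acs S c x u) (acs S c x v))
            = met S c x (pair_arg u v)],
      is_tensor (psi_re S) /\ is_tensor (psi_im S)
    & forall (c : chart M) x, cimg c x ->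
        exists (U : set 'rV[R]_(2 * n))
               (e : 'I_n -> 'rV[R]_(2 * n) -> 'rV[R]_(2 * n)),
          [/\ open U, U x, U `<=` cimg c,
              forall i, smooth_map_on U (e i)
            & forall y, U y -> adapted S c y (fun i => e i y)]].

(* [omega(x, y) = <x, I y>] *)
Definition kaehler (R : realType) (n : nat) (M : manifold R (2 * n))
    (S : su_data M) : tensor M 2 :=
  fun c x v => met S c x (pair_arg (v ord0) (acs S c x (v ord_max))).

(* [(I mu)(X) = - mu(I X)] *)
Definition act_form (R : realType) (m : nat) (M : manifold R m)
    (A : endo M) (mu : tensor M 1) : tensor M 1 :=
  fun c x v => - mu c x (fun i => A c x (v i)).

(* [xi_X Y = - 1/2 I (nabla_X I) Y] *)
Definition xi_part (R : realType) (n : nat) (M : manifold R (2 * n))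
    (S : su_data M) (D : connection M) (c : chart M)
    (x u v : 'rV[R]_(2 * n)) : 'rV[R]_(2 * n) :=
  - (2%:R^-1 *: acs S c x (cov_endo D (acs S) c x u v)).

(* [eta_X Y = (I eta)(X) I Y] *)
Definition eta_part (R : realType) (n : nat) (M : manifold R (2 * n))
    (S : su_data M) (eta : tensor M 1) (c : chart M)
    (x u v : 'rV[R]_(2 * n)) : 'rV[R]_(2 * n) :=
  act_form (acs S) eta c x (fun=> u) *: acs S c x v.

Definition minimal_connection (R : realType) (n : nat)
    (M : manifold R (2 * n)) (S : su_data M) (D : connection M)
    (eta : tensor M 1) : connection M :=
  fun c x u v =>
    D c x u v + eta_part S eta c x u v + xi_part S D c x u v.

(* [eta] is the W_5 one-form of [S], whose Levi-Civita connection is [D]: the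
   one-form for which [nabla + eta + xi] is an SU(n)-connection. *)
Definition is_W5_form (R : realType) (n : nat) (M : manifold R (2 * n))
    (S : su_data M) (D : connection M) (eta : tensor M 1) : Prop :=
  is_tensor eta /\
  let D' := minimal_connection S D eta in
  [/\ parallel D' (met S), parallel D' (kaehler S),
      parallel D' (psi_re S) & parallel D' (psi_im S)].

Definition rescale (R : realType) (m : nat) (M : manifold R m) (k : nat)
    (h : M -> R) (T : tensor M k) : tensor M k :=
  fun c x v => h (cinv c x) * T c x v.

(* The metric is multiplied by [e^(2f)] and the complex volume form by
   [e^(nf)]. *)
Definition conformal_change (R : realType) (n : nat)
    (M : manifold R (2 * n)) (f : M -> R) (S : su_data M) : su_data M :=
  SUData (rescale (fun p => expR (2%:R * f p)) (met S)) (acs S)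
         (rescale (fun p => expR (n%:R * f p)) (psi_re S))
         (rescale (fun p => expR (n%:R * f p)) (psi_im S)).

(* Main.v *)
Require Import Defs.
From HB Require Import structures.
From mathcomp Require Import all_boot all_order all_algebra.
From mathcomp Require Import complex.
From mathcomp Require Import all_classical all_reals all_analysis.
From mathcomp Require Import ring lra.

Set Implicit Arguments.
Unset Strict Implicit.
Unset Printing Implicit Defensive.

Import Order.TTheory GRing.Theory Num.Theory.
Import numFieldNormedType.Exports.

Local Open Scope classical_set_scope.
Local Open Scope ring_scope.

(** Everything happens at one point [x] of one chart.  Write [g] for the metric,
    [I] for the almost complex structure, [phi = df], and
    [A u v = Do_u v - D_u v] for the difference of the two Levi-Civita
    connections at [x].

    Both connections are torsion-free and metric, so [A] is symmetric and
    [2 phi(u) g(v, w) = g(A u v, w) + g(v, A u w)]; the Koszul trick gives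
    [g(A u v, w) = phi(u) g(v, w) + phi(v) g(u, w) - phi(w) g(u, v)]
    ([levi_civita_conformal]).

    For W_4, the two covariant derivatives of the Kaehler forms differ by an
    explicit form in [phi], [g] and [I], up to the factor [e^(2f)]
    ([cov_kaehler_conformal]).  Its trace over an orthonormal frame of [g] is
    [(2n - 2) phi(I b)]; the factor [e^(2f)] is absorbed by the passage from an
    orthonormal frame of [e^(2f) g] to one of [g].  The two frames of the
    statement being unrelated, this uses that traces of bilinear forms do not
    depend on the orthonormal frame ([trace_orthonormal]), hence that the
    covariant derivative of the Kaehler form is linear in its direction.  For a
    directional derivative this is a genuine analytic fact, obtained from the
    mean value theorem and the continuity of the derivatives
    ([derive_linear_dir]).

    For W_5, evaluate the parallelism of [psi_-] on an adapted frame
    [e_1, ..., e_n] at [x].  There [psi_-(e_1, ..., e_n) = 0], and replacing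
    [e_k] by [w] gives [g(I e_k, w)]; so [sum_k g(I e_k, D'_u e_k)] is the
    derivative of [psi_-(e_1, ..., e_n)] with the [e_k] frozen, for the minimal
    connections of both structures (the derivative of the factor [e^(nf)] is
    multiplied by [psi_-(e_1, ..., e_n) = 0]).  Their difference
    [A u v - 1/2 (A u v + I (A u (I v))) + (eta - eta_o)(I u) I v]
    ([minimal_connection_conformal]) therefore has
    [- phi(I u) + n (eta - eta_o)(I u) = 0] ([unitary_contorsion_trace]), which
    is the formula for [eta_o] as [I] is onto.  In the combination
    [2n(n-1) eta - I d^* omega] the two multiples of [df] cancel. *)

(** * Directional derivatives *)

Lemma is_derive_line (R : realType) (V : normedModType R) (f : V -> R)
    (p w : V) (r : R) :
  derivable f (r *: w + p) w ->
  is_derive r 1 (fun s : R => f (s *: w + p)) ('D_w f (r *: w + p)).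
Proof.
have E : (fun h : R => h^-1 *: (((fun s : R => f (s *: w + p)) \o shift r)
            (h *: 1) - f (r *: w + p)))
       = (fun h : R => h^-1 *: ((f \o shift (r *: w + p)) (h *: w)
            - f (r *: w + p))).
  by apply/funext => h /=; rewrite [h *: 1]mulr1 scalerDl addrA.
by move=> df; split; rewrite /derivable /derive E.
Qed.

(** Stated for steps [s] of either sign, so that it applies to the difference
    quotients that define a derivative. *)
Lemma mean_value_line (R : realType) (V : normedModType R) (f : V -> R)
    (p w : V) (s : R) :
  (forall r, `|r| <= `|s| -> derivable f (r *: w + p) w) ->
  exists2 r, `|r| <= `|s| & f (s *: w + p) - f p = s * 'D_w f (r *: w + p).
Proof.
move=> df; pose phi (r : R) := f (r *: w + p).
have mv a b : a <= b -> (forall r, a <= r <= b -> `|r| <= `|s|) ->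
    exists2 c, `|c| <= `|s| & phi b - phi a = 'D_w f (c *: w + p) * (b - a).
  move=> ab small.
  have dphi r : r \in `[a, b]%R -> is_derive r 1 phi ('D_w f (r *: w + p)).
    by rewrite in_itv /= => /small /df; exact: is_derive_line.
  have cphi : {within `[a, b], continuous phi}.
    by apply: derivable_within_continuous => r /dphi [].
  have dphi' r : r \in `]a, b[%R -> is_derive r 1 phi ('D_w f (r *: w + p)).
    by move=> rab; apply: dphi; apply: subset_itv_oo_cc rab.
  have [c cab E] := MVT_segment ab dphi' cphi.
  by exists c; [apply: small; move: cab; rewrite in_itv|].
have phi0 : phi 0 = f p by rewrite /phi scale0r add0r.
have [s0|/ltW s0] := leP 0 s.
  have [r|c cs E] := mv _ _ s0; first by case/andP=> r0 rs; rewrite !ger0_norm.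
  by exists c => //; rewrite -phi0 -[f _]/(phi s) E subr0 mulrC.
have [r|c cs E] := mv _ _ s0; first by case/andP=> r0 rs; rewrite !ler0_norm// lerN2.
by exists c => //; rewrite -phi0 -[f _]/(phi s) -opprB E sub0r mulrN opprK mulrC.
Qed.

(** The increment from [x] to [x + t (a u + w)] is split at [x + t w]; each half
    is a derivative at an intermediate point by the mean value theorem, and
    these derivatives converge by continuity at [x]. *)
Lemma derive_linear_dir (R : realType) (V : normedModType R) (U : set V)
    (h : V -> R) (a : R) (u w x : V) :
  open U -> U x ->
  (forall y v, U y -> derivable h y v) ->
  {for x, continuous (fun y => 'D_u h y)} ->
  {for x, continuous (fun y => 'D_w h y)} ->
  'D_(a *: u + w) h x = a * 'D_u h x + 'D_w h x.
Proof.
move=> oU Ux dh cu cw.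
apply: cvg_lim => //; apply/cvgrPdist_lt => e e0.
set L := a * _ + _.
(* The error will be at most [`|a| * e1 + e1]; the extra [1] makes it
   strictly smaller than [e]. *)
pose e1 := e / (`|a| + 1 + 1).
have a1 : 0 < `|a| + 1 + 1 :> R by have := normr_ge0 a; lra.
have e10 : 0 < e1 by rewrite divr_gt0.
have : \forall y \near x, [/\ U y, `|'D_u h x - 'D_u h y| < e1
                             & `|'D_w h x - 'D_w h y| < e1].
  have nu : \forall y \near x, `|'D_u h x - 'D_u h y| < e1.
    by move/cvgrPdist_lt : cu; apply.
  have nw : \forall y \near x, `|'D_w h x - 'D_w h y| < e1.
    by move/cvgrPdist_lt : cw; apply.
  have nU : \forall y \near x, U y by exact: open_nbhs_nbhs.
  by move: nU nu nw; apply: filterS3 => y.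
move=> /nbhs_ballP [d /= d0 dP].
have near_x q1 q2 t : `|t| * (`|a| * `|u| + `|w| + 1) < d ->
    `|q1| <= `|t * a| -> `|q2| <= `|t| -> ball x d (q1 *: u + (q2 *: w + x)).
  move=> td q1t q2t; rewrite -ball_normE /ball_ /=.
  have -> : x - (q1 *: u + (q2 *: w + x)) = - (q1 *: u + q2 *: w).
    by rewrite addrA opprD addrCA subrr addr0.
  rewrite normrN (le_lt_trans (ler_normD _ _))// !normrZ.
  apply: le_lt_trans td; rewrite !mulrDr mulr1 mulrA -normrM.
  have := ler_wpM2r (normr_ge0 u) q1t; have := ler_wpM2r (normr_ge0 w) q2t.
  by have := normr_ge0 t; lra.
near=> t.
have t0 : t != 0 by near: t; exact: nbhs_dnbhs_neq.
have td : `|t| * (`|a| * `|u| + `|w| + 1) < d.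
  have c0 : 0 < `|a| * `|u| + `|w| + 1.
    by rewrite ltr_wpDl// addr_ge0// mulr_ge0.
  by rewrite -ltr_pdivlMr//; near: t; apply: dnbhs0_lt; rewrite divr_gt0.
have [r rt Er] : exists2 r, `|r| <= `|t * a| &
   h ((t * a) *: u + (t *: w + x)) - h (t *: w + x)
     = (t * a) * 'D_u h (r *: u + (t *: w + x)).
  by apply: mean_value_line => r rt; apply: dh; case: (dP _ (near_x r t t td rt (lexx _))).
have [q qt Eq] : exists2 q, `|q| <= `|t| &
   h (t *: w + x) - h x = t * 'D_w h (q *: w + x).
  apply: mean_value_line => q qt; apply: dh.
  have := near_x 0 q t td; rewrite normr0 => /(_ (normr_ge0 _) qt)/dP.
  by rewrite scale0r add0r; case.
have [_ du _] := dP _ (near_x r t t td rt (lexx _)).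
have := near_x 0 q t td; rewrite normr0 => /(_ (normr_ge0 _) qt)/dP.
rewrite scale0r add0r => -[_ _ dw].
have -> : ((h \o shift x) (t *: (a *: u + w)) - h x)
    = t * (a * 'D_u h (r *: u + (t *: w + x)) + 'D_w h (q *: w + x)).
  rewrite mulrDr mulrA -Er -Eq addrA subrK /=.
  by rewrite scalerDr scalerA addrA.
rewrite [X in `|L - X|]mulKf// /L.
set A := 'D_u h (r *: _ + _) in du *; set B := 'D_w h (_ + x) in dw *.
have -> : a * 'D_u h x + 'D_w h x - (a * A + B) = a * ('D_u h x - A) + ('D_w h x - B) by ring.
apply: le_lt_trans (ler_normD _ _) _; rewrite normrM.
have := ler_wpM2l (normr_ge0 a) (ltW du).
have -> : e = `|a| * e1 + e1 + e1.
  by rewrite -[in LHS](divfK (lt0r_neq0 a1) e) -/e1; ring.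
lra.
Unshelve. all: by end_near. Qed.

Lemma smooth_derivable (R : realType) (m : nat) (U : set 'rV[R]_m) h x v :
  smooth_on U h -> U x -> derivable h x v.
Proof. by move=> hU Ux; have [_] := hU [::] x Ux; apply. Qed.

Lemma smooth_derive_linear (R : realType) (m : nat) (U : set 'rV[R]_m) h x a u w :
  open U -> smooth_on U h -> U x ->
  'D_(a *: u + w) h x = a * 'D_u h x + 'D_w h x.
Proof.
move=> oU hU Ux; apply: (@derive_linear_dir R 'rV[R]_m U h a u w x oU Ux).
- by move=> y v; exact: smooth_derivable.
- by have [] := hU [:: u] x Ux.
- by have [] := hU [:: w] x Ux.
Qed.

Lemma derive_expM (R : realType) (V : normedModType R) (k h : V -> R) (a : R) (x u : V) :
  derivable h x u -> derivable k x u ->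
  'D_u (fun y => expR (a * h y) * k y) x
  = expR (a * h x) * (a * 'D_u h x * k x + 'D_u k x).
Proof.
move=> dh dk.
have [de Ee] : is_derive x u (fun y => expR (a * h y)) (expR (a * h x) * (a * 'D_u h x)).
  (* The chain rule is applied on the line through [x] in direction [u]. *)
  pose l (s : R) := a * h (s *: u + x).
  have l0 : l 0 = a * h x by rewrite /l scale0r add0r.
  have [dl El] : is_derive (0 : R) 1 l (a * 'D_u h x).
    have dh0 : derivable h (0 *: u + x) u by rewrite scale0r add0r.
    have := is_derive_line dh0; rewrite scale0r add0r => dl.
    exact: is_deriveZ.
  have de : derivable (@expR R \o l) 0 1.
    have dfl : differentiable l 0 by exact/derivable1_diffP.
    have dfe : differentiable (@expR R) (l 0).
      exact: (proj1 (derivable1_diffP (@expR R) (l 0)) (@derivable_expR R (l 0))).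
    exact: (proj2 (derivable1_diffP (@expR R \o l) 0) (differentiable_comp dfl dfe)).
  have := @derive1_comp R l (@expR R) 0 dl (@derivable_expR R _).
  rewrite !derive1E El l0 derive_val => E.
  split; first exact/derivable1P.
  move: E; rewrite /derive /=.
  have -> // : (fun h0 : R => h0^-1 *: (expR (l (h0 *: 1 + 0)) - expR (l 0)))
    = (fun h0 : R => h0^-1 *: (expR (a * h (h0 *: u + x)) - expR (a * h x))).
  by apply/funext => s; rewrite l0 /l addr0 [s *: 1]mulr1.
have [_] := is_deriveM (DeriveDef de Ee) (derivableP dk).
rewrite /GRing.scale /= => E; rewrite [LHS]E; ring.
Qed.

(** * Linear algebra in a tangent space *)

(** In the expansion along column [i] the cofactors do not see that column, so
    they are those of the identity matrix. *)
Lemma det_identity_but_one_col (K : comNzRingType) (n : nat) (A : 'M[K]_n) (i : 'I_n) :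
  (forall k l, l != i -> A k l = (k == l)%:R) -> \det A = A i i.
Proof.
move=> hA; rewrite (expand_det_col A i).
have adj1 : \adj (1%:M : 'M[K]_n) = 1%:M.
  by have := mul_mx_adj (1%:M : 'M[K]_n); rewrite mul1mx det1.
have cof k : cofactor A k i = (i == k)%:R.
  have -> : cofactor A k i = \adj (1%:M : 'M[K]_n) i k.
    rewrite mxE /cofactor; congr (_ * \det _).
    by apply/matrixP => a b; rewrite !mxE hA // eq_sym neq_lift.
  by rewrite adj1 mxE.
rewrite (bigD1 i) //= cof eqxx mulr1 big1 ?addr0 // => k /negbTE ki.
by rewrite cof eq_sym ki mulr0.
Qed.

Lemma is_scalarP (K : pzRingType) (V : lmodType K) (h : V -> K) :
  scalar h -> exists F : {scalar V}, h = F.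
Proof.
by move=> hh; exists (HB.pack_for {scalar V} h (GRing.isLinear.Build _ _ _ _ h hh)).
Qed.

Lemma is_scalar_sum (K : pzRingType) (V : lmodType K) (h : V -> K) (hh : scalar h)
    (J : finType) (a : J -> K) (F : J -> V) :
  h (\sum_j a j *: F j) = \sum_j a j * h (F j).
Proof.
have [H ->] := is_scalarP hh.
by rewrite linear_sum; apply: eq_bigr => j _; rewrite linearZ.
Qed.

Lemma is_scalarN (K : pzRingType) (V : lmodType K) (h : V -> K) (hh : scalar h) u :
  h (- u) = - h u.
Proof. by have [H ->] := is_scalarP hh; rewrite linearN. Qed.

Lemma is_scalarD (K : pzRingType) (V : lmodType K) (h : V -> K) (hh : scalar h) u v :
  h (u + v) = h u + h v.
Proof. by have [H ->] := is_scalarP hh; rewrite linearD. Qed.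

Lemma is_scalarZ (K : pzRingType) (V : lmodType K) (h : V -> K) (hh : scalar h) a u :
  h (a *: u) = a * h u.
Proof. by have [H ->] := is_scalarP hh; rewrite linearZ. Qed.

Definition bilinear_form (K : pzRingType) (V : lmodType K) (g : V -> V -> K) :=
  (forall v, scalar (g^~ v)) /\ (forall u, scalar (g u)).

Definition orthonormal (K : pzRingType) (V : Type) (g : V -> V -> K)
    (J : finType) (e : J -> V) :=
  forall i j, g (e i) (e j) = (i == j)%:R.

(** With [E] the matrix of rows [e i] and [C] the matrix of [v |-> (g v (e i))_i],
    orthonormality says [E *m C = 1]; the expansion of every vector is
    [C *m E = 1]. *)
Lemma orthonormal_expansion (K : comUnitRingType) (m : nat)
    (g : 'rV[K]_m -> 'rV[K]_m -> K) (hg : bilinear_form g)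
    (e : 'I_m -> 'rV[K]_m) (he : orthonormal g e) (u : 'rV[K]_m) :
  u = \sum_i g u (e i) *: e i.
Proof.
pose E := \matrix_i e i.
pose C := \matrix_(k, i) g (delta_mx 0 k) (e i).
have mulC (v : 'rV[K]_m) i : (v *m C) 0 i = g v (e i).
  rewrite [in RHS](row_sum_delta v) (is_scalar_sum (hg.1 _)) mxE.
  by apply: eq_bigr => k _; rewrite mxE.
have EC : E *m C = 1%:M.
  apply/matrixP => i j; rewrite [RHS]mxE -he -mulC.
  have -> : e i = row i E by rewrite rowK.
  by rewrite -row_mul [RHS]mxE.
rewrite -[LHS]mulmx1 -(mulmx1C EC) mulmxA mulmx_sum_row.
by apply: eq_bigr => i _; rewrite mulC rowK.
Qed.

(** Any index type of the right size: an adapted frame [e, I e] of a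
    [2 n]-dimensional space is naturally indexed by ['I_n + 'I_n]. *)
Lemma orthonormal_expansion_fin (K : comUnitRingType) (m : nat)
    (g : 'rV[K]_m -> 'rV[K]_m -> K) (hg : bilinear_form g) (J : finType)
    (cardJ : #|J| = m) (e : J -> 'rV[K]_m) (he : orthonormal g e)
    (u : 'rV[K]_m) :
  u = \sum_i g u (e i) *: e i.
Proof.
pose s (i : 'I_m) : J := enum_val (cast_ord (esym cardJ) i).
have sb : bijective s.
  exists (fun j => cast_ord cardJ (enum_rank j)) => i.
    by rewrite /s enum_valK cast_ordKV.
  by rewrite /s cast_ordK enum_rankK.
rewrite [RHS](reindex s); last exact: onW_bij.
apply: orthonormal_expansion => // i j.
by rewrite he (inj_eq (bij_inj sb)).
Qed.

(** Expand one argument of [B (e i) (e i)] in the frame [e'], exchange the sums,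
    and recognize the expansion of [e' j] in the frame [e]. *)
Lemma trace_orthonormal (K : comUnitRingType) (m : nat)
    (g : 'rV[K]_m -> 'rV[K]_m -> K) (hg : bilinear_form g)
    (gC : forall u v, g u v = g v u) (B : 'rV[K]_m -> 'rV[K]_m -> K)
    (hB : bilinear_form B) (e e' : 'I_m -> 'rV[K]_m)
    (he : orthonormal g e) (he' : orthonormal g e') :
  \sum_i B (e i) (e i) = \sum_i B (e' i) (e' i).
Proof.
transitivity (\sum_i \sum_j g (e i) (e' j) * B (e' j) (e i)).
  apply: eq_bigr => i _.
  by rewrite {1}(orthonormal_expansion hg he' (e i)) (is_scalar_sum (hB.1 _)).
rewrite exchange_big; apply: eq_bigr => j _ /=.
rewrite [X in _ = B _ X](orthonormal_expansion hg he (e' j)) (is_scalar_sum (hB.2 _)).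
by apply: eq_bigr => i _; rewrite gC.
Qed.

Lemma trace_scalar (K : comUnitRingType) (m : nat)
    (g : 'rV[K]_m -> 'rV[K]_m -> K) (hg : bilinear_form g)
    (h : 'rV[K]_m -> K) (hh : scalar h) (e : 'I_m -> 'rV[K]_m)
    (he : orthonormal g e) u :
  \sum_i g u (e i) * h (e i) = h u.
Proof.
by rewrite {2}(orthonormal_expansion hg he u) (is_scalar_sum hh).
Qed.

Record hermitian (K : comUnitRingType) (V : lmodType K) (g : V -> V -> K)
    (I : V -> V) : Prop := Hermitian {
  herm_bilin : bilinear_form g;
  herm_sym : forall u v, g u v = g v u;
  herm_lin : linear I;
  herm_sqr : forall u, I (I u) = - u;
  herm_orth : forall u v, g (I u) (I v) = g u v
}.

Lemma herm_skew (K : comUnitRingType) (V : lmodType K) (g : V -> V -> K)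
    (I : V -> V) : hermitian g I -> forall u v, g (I u) v = - g u (I v).
Proof.
move=> h u v; rewrite -(herm_orth h) (herm_sqr h).
by rewrite (is_scalarN ((herm_bilin h).1 _)).
Qed.

Lemma scalar_comp_linear (K : comUnitRingType) (V : lmodType K) (I : V -> V) (h : V -> K) :
  linear I -> scalar h -> scalar (h \o I).
Proof. by move=> lI sh a u v /=; rewrite lI sh. Qed.

(** The Koszul trick: add the hypothesis for [(u, v, w)] and [(v, u, w)] and
    subtract it for [(w, u, v)]. *)
Lemma conformal_difference (K : realFieldType) (V : lmodType K)
    (g : V -> V -> K) (A : V -> V -> V) (phi : V -> K) :
  (forall u v, g u v = g v u) ->
  (forall u v, A u v = A v u) ->
  (forall u v w, 2 * phi u * g v w = g (A u v) w + g v (A u w)) ->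
  forall u v w, g (A u v) w = phi u * g v w + phi v * g u w - phi w * g u v.
Proof.
move=> gC AC H u v w.
have := H u v w; have := H v u w; have := H w u v.
rewrite [A v u]AC [A w u]AC [A w v]AC [g v (A u w)]gC [g u (A v w)]gC.
lra.
Qed.

(** The left-hand side is what the conformal factor and the change [A] of
    connection contribute to the covariant derivative of [g a (I b)] in
    direction [u].  The terms in [phi u] cancel. *)
Lemma conformal_kaehler_difference (K : realFieldType) (V : lmodType K)
    (g : V -> V -> K) (I : V -> V) (A : V -> V -> V) (phi : V -> K) :
  hermitian g I ->
  (forall u v w, g (A u v) w = phi u * g v w + phi v * g u w - phi w * g u v) ->
  forall u a b,
    2 * phi u * g a (I b) - g (A u a) (I b) - g a (I (A u b))
    = - phi a * g u (I b) + phi (I b) * g u a + phi b * g u (I a) - phi (I a) * g u b.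
Proof.
move=> h HA u a b; have gC := herm_sym h.
have -> : g a (I (A u b)) = - g (A u b) (I a).
  by rewrite -[RHS](herm_skew h) gC.
rewrite !HA; have -> : g b (I a) = - g a (I b) by rewrite gC (herm_skew h).
ring.
Qed.

Lemma trace_kaehler_difference (K : realFieldType) (m : nat)
    (g : 'rV[K]_m -> 'rV[K]_m -> K) (I : 'rV[K]_m -> 'rV[K]_m)
    (phi : 'rV[K]_m -> K) (e : 'I_m -> 'rV[K]_m) :
  hermitian g I -> scalar phi -> orthonormal g e ->
  forall b,
  \sum_i (- phi (e i) * g (e i) (I b) + phi (I b) * g (e i) (e i)
          + phi b * g (e i) (I (e i)) - phi (I (e i)) * g (e i) b)
  = (m%:R - 2) * phi (I b).
Proof.
move=> h sphi he b; have gC := herm_sym h.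
have isotropic a : g a (I a) = 0.
  by have := herm_skew h a a; rewrite gC; lra.
rewrite !big_split /= !sumrN.
under eq_bigr do rewrite mulNr gC mulrC.
rewrite sumrN trace_scalar//; last exact: herm_bilin h.
under [X in _ + X + _ - _]eq_bigr do rewrite he eqxx mulr1.
rewrite sumr_const card_ord.
under [X in _ + X - _]eq_bigr do rewrite isotropic mulr0.
rewrite big1_eq.
under eq_bigr do rewrite gC mulrC.
rewrite (@trace_scalar _ _ g (herm_bilin h) (phi \o I))//; last first.
  exact: scalar_comp_linear (herm_lin h) sphi.
rewrite /= -mulr_natl; ring.
Qed.

Lemma kaehler_difference_bilinear (K : realFieldType) (V : lmodType K)
    (g : V -> V -> K) (I : V -> V) (phi : V -> K) :
  hermitian g I -> scalar phi -> forall b,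
  bilinear_form (fun u a => - phi a * g u (I b) + phi (I b) * g u a
                            + phi b * g u (I a) - phi (I a) * g u b).
Proof.
move=> h sphi b; have [gl gr] := herm_bilin h.
split=> [a|u] k p q /=.
  rewrite (gl (I b) k p q) (gl a k p q) (gl (I a) k p q) (gl b k p q); ring.
rewrite (herm_lin h k p q) !(sphi k _ _) !(gr u k _ _); ring.
Qed.

Lemma bilinear_formD (K : comPzRingType) (V : lmodType K) (g1 g2 : V -> V -> K) :
  bilinear_form g1 -> bilinear_form g2 ->
  bilinear_form (fun u v => g1 u v + g2 u v).
Proof.
move=> [l1 r1] [l2 r2]; split=> [v|u] k p q /=.
  by rewrite (l1 v k p q) (l2 v k p q) mulrDr addrACA.
by rewrite (r1 u k p q) (r2 u k p q) mulrDr addrACA.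
Qed.

(** The endomorphism [v |-> A u v - 1/2 (A u v + I (A u (I v)))] is the
    complex-linear part of [A u]; the sum is the imaginary part of its complex
    trace.  The terms in [phi u] vanish since [e] and [I e] are orthogonal, and
    the remaining ones expand [I u] in the frame [e, I e]. *)
Lemma unitary_contorsion_trace (K : realFieldType) (n : nat)
    (g : 'rV[K]_(2 * n) -> 'rV[K]_(2 * n) -> K)
    (I : 'rV[K]_(2 * n) -> 'rV[K]_(2 * n))
    (A : 'rV[K]_(2 * n) -> 'rV[K]_(2 * n) -> 'rV[K]_(2 * n))
    (phi : 'rV[K]_(2 * n) -> K) (e : 'I_n -> 'rV[K]_(2 * n)) :
  hermitian g I -> scalar phi ->
  (forall u v w, g (A u v) w = phi u * g v w + phi v * g u w - phi w * g u v) ->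
  orthonormal g e -> (forall i j, g (e i) (I (e j)) = 0) ->
  forall u,
  \sum_k g (I (e k)) (A u (e k) - 2^-1 *: (A u (e k) + I (A u (I (e k)))))
  = - phi (I u).
Proof.
move=> h sphi HA he heI u; have gC := herm_sym h; have [gl gr] := herm_bilin h.
have exp_Iu : phi (I u) =
   \sum_k (g u (e k) * phi (I (e k)) - g u (I (e k)) * phi (e k)).
  pose F (j : 'I_n + 'I_n) := match j with inl k => e k | inr k => I (e k) end.
  have hF : orthonormal g F.
    move=> [i|i] [j|j] /=; rewrite ?he ?heI //.
    - by rewrite gC heI.
    - by rewrite (herm_orth h) he.
  have cardF : #|{: 'I_n + 'I_n}| = (2 * n)%N.
    by rewrite card_sum card_ord addnn mul2n.
  have sI := scalar_comp_linear (herm_lin h) sphi.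
  rewrite -[LHS]/((phi \o I) u).
  rewrite [in LHS](orthonormal_expansion_fin (herm_bilin h) cardF hF u).
  rewrite (is_scalar_sum sI) big_sumType /= -big_split /=.
  by apply: eq_bigr => k _; rewrite (herm_sqr h) (is_scalarN sphi) mulrN.
rewrite exp_Iu -sumrN; apply: eq_bigr => k _.
rewrite (is_scalarD (gr _)) (is_scalarN (gr _)) (is_scalarZ (gr _)) (is_scalarD (gr _)).
rewrite (herm_orth h) [g (I (e k)) _]gC [g (e k) (A _ _)]gC !HA.
rewrite (gC (I (e k)) (e k)) heI.
lra.
Qed.

(** * Tensors in a chart *)

Lemma upd_pair_l (T : Type) (u v w : T) : upd (pair_arg u v) ord0 w = pair_arg w v.
Proof. by apply/funext => j; rewrite /upd /pair_arg; case: eqP. Qed.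

Lemma upd_pair_r (T : Type) (u v w : T) (i : 'I_2) :
  i != ord0 -> upd (pair_arg u v) i w = pair_arg u w.
Proof.
move=> i0; apply/funext => j; rewrite /upd /pair_arg.
case: (eqVneq j i) => [->|]; first by rewrite (negbTE i0).
by case: j i i0 => [[|[|//]] ?] [[|[|//]] ?].
Qed.

Lemma cov_tensor_pair (R : realType) (m : nat) (M : manifold R m)
    (D : connection M) (T : tensor M 2) (c : chart M) (x u a b : 'rV[R]_m) :
  cov_tensor D T c x u (pair_arg a b)
  = 'D_u (fun y => T c y (pair_arg a b)) x
    - (T c x (pair_arg (D c x u a) b) + T c x (pair_arg a (D c x u b))).
Proof.
by rewrite /cov_tensor big_ord_recl big_ord1 /= upd_pair_l upd_pair_r.
Qed.

Lemma tensor_bilinear (R : realType) (m : nat) (M : manifold R m)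
    (T : tensor M 2) (c : chart M) (x : 'rV[R]_m) :
  is_tensor T -> cimg c x -> bilinear_form (fun u v => T c x (pair_arg u v)).
Proof.
move=> [linT _ _] cx; split=> [v|u] a p q.
  by have := linT c x cx (pair_arg p v) ord0 a p q; rewrite !upd_pair_l.
by have := linT c x cx (pair_arg u p) ord_max a p q; rewrite !upd_pair_r.
Qed.

Lemma tensor_derivable (R : realType) (m : nat) (M : manifold R m) (k : nat)
    (T : tensor M k) (c : chart M) (x u : 'rV[R]_m) v :
  is_tensor T -> cimg c x -> derivable (fun y => T c y v) x u.
Proof. by move=> [_ sT _]; exact: smooth_derivable. Qed.

Lemma differential_scalar (R : realType) (m : nat) (M : manifold R m)
    (f : M -> R) (c : chart M) (x : 'rV[R]_m) :
  smooth_function f -> cimg c x -> scalar (fun u => differential f c x (fun=> u)).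
Proof.
move=> sf cx a u w; rewrite /differential /=.
exact: (smooth_derive_linear a u w (@cimg_open _ _ M c) (sf c) cx).
Qed.

Lemma derive_rescale (R : realType) (m : nat) (M : manifold R m) (k : nat)
    (f : M -> R) (a : R) (T : tensor M k) (c : chart M) (x u : 'rV[R]_m) v :
  smooth_function f -> cimg c x -> derivable (fun y => T c y v) x u ->
  'D_u (fun y => rescale (fun p => expR (a * f p)) T c y v) x
  = expR (a * f (cinv c x))
    * (a * differential f c x (fun=> u) * T c x v + 'D_u (fun y => T c y v) x).
Proof.
move=> sf cx dT.
have df : derivable (fun y => f (cinv c y)) x u by exact: smooth_derivable (sf c) cx.
exact: (derive_expM a df dT).
Qed.

Lemma su_hermitian (R : realType) (n : nat) (M : manifold R (2 * n))
    (S : su_data M) (c : chart M) (x : 'rV[R]_(2 * n)) :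
  is_su_structure S -> cimg c x ->
  hermitian (fun u v => met S c x (pair_arg u v)) (acs S c x).
Proof.
move=> [[tg sg _] [[lI _ _] sI oI] _ _] cx.
split; [exact: tensor_bilinear|exact: sg|exact: lI|exact: sI|exact: oI].
Qed.

(** * Conformal change of the Levi-Civita connection and of the Kaehler form *)

Lemma levi_civita_conformal (R : realType) (n : nat) (M : manifold R (2 * n))
    (S : su_data M) (f : M -> R) (D Do : connection M)
    (c : chart M) (x : 'rV[R]_(2 * n)) :
  is_metric (met S) -> smooth_function f ->
  levi_civita (met S) D -> levi_civita (met (conformal_change f S)) Do ->
  cimg c x ->
  let g u v := met S c x (pair_arg u v) in
  let df u := differential f c x (fun=> u) in
  forall u v w, g (Do c x u v - D c x u v) w
                = df u * g v w + df v * g u w - df w * g u v.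
Proof.
move=> [tg sg _] sf [_ torD parD] [_ torDo parDo] cx g df.
have [gl gr] : bilinear_form g by exact: tensor_bilinear.
apply: (conformal_difference (A := fun u v => Do c x u v - D c x u v)).
- by move=> u v; exact: sg.
- by move=> u v; rewrite torDo// torD.
move=> u v w.
have := parD c x cx u (pair_arg v w); have := parDo c x cx u (pair_arg v w).
rewrite !cov_tensor_pair [X in X - _ = _ -> _]derive_rescale//; last exact: tensor_derivable.
rewrite /rescale -!mulrDr -mulrBr => /eqP.
rewrite mulf_eq0 gt_eqF ?expR_gt0 //= => /eqP.
rewrite -!/(g _ _) -/(df u) !(is_scalarD (gl _)) !(is_scalarD (gr _)) !(is_scalarN (gl _)) !(is_scalarN (gr _)).
lra.
Qed.

(** Separates the two dependences on the point [y], that of the metric and that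
    of the almost complex structure, into scalar functions to which the product
    rule applies. *)
Lemma kaehler_expansion (R : realType) (n : nat) (M : manifold R (2 * n))
    (S : su_data M) (c : chart M) (y a b : 'rV[R]_(2 * n)) :
  is_metric (met S) -> cimg c y ->
  kaehler S c y (pair_arg a b)
  = \sum_(j < 2 * n) acs S c y b 0 j * met S c y (pair_arg a (delta_mx 0 j)).
Proof.
move=> [tg _ _] cy; rewrite /kaehler /= [acs S c y b in LHS]row_sum_delta.
exact: (is_scalar_sum ((tensor_bilinear tg cy).2 a)).
Qed.

Lemma kaehler_derive (R : realType) (n : nat) (M : manifold R (2 * n))
    (S : su_data M) (c : chart M) (x a b u : 'rV[R]_(2 * n)) :
  is_metric (met S) -> is_endo (acs S) -> cimg c x ->
  is_derive x u (fun y => kaehler S c y (pair_arg a b))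
    (\sum_(j < 2 * n)
       (acs S c x b 0 j * 'D_u (fun y => met S c y (pair_arg a (delta_mx 0 j))) x
        + met S c x (pair_arg a (delta_mx 0 j)) * 'D_u (fun y => acs S c y b 0 j) x)).
Proof.
move=> mS [_ sI _] cx; have [tg _ _] := mS.
pose F (j : 'I_(2 * n)) := (fun y => acs S c y b 0 j)
                 * (fun y => met S c y (pair_arg a (delta_mx 0 j))).
apply: (@near_eq_is_derive _ _ _ (\sum_j F j)).
  have := open_nbhs_nbhs (conj (@cimg_open _ _ M c) cx).
  apply: filterS => y cy; rewrite (kaehler_expansion a b mS cy).
  by rewrite fct_sumE.
apply: is_derive_sum => j; apply: is_deriveM.
  by apply/derivableP; exact: smooth_derivable (sI c b j) cx.
by apply/derivableP; exact: tensor_derivable.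
Qed.

Lemma kaehlerE (R : realType) (n : nat) (M : manifold R (2 * n))
    (S : su_data M) (c : chart M) (x u v : 'rV[R]_(2 * n)) :
  kaehler S c x (pair_arg u v) = met S c x (pair_arg u (acs S c x v)).
Proof. by []. Qed.

Lemma kaehler_bilinear (R : realType) (n : nat) (M : manifold R (2 * n))
    (S : su_data M) (c : chart M) (x : 'rV[R]_(2 * n)) :
  is_metric (met S) -> is_endo (acs S) -> cimg c x ->
  bilinear_form (fun u v => kaehler S c x (pair_arg u v)).
Proof.
move=> [tg _ _] [lI _ _] cx; have [gl gr] := tensor_bilinear tg cx.
split=> [v|u] a p q; rewrite !kaehlerE.
  exact: (gl (acs S c x v) a p q).
by rewrite lI//; exact: (gr u a _ _).
Qed.

(** Tensoriality in the direction [u] and in the first slot [a], which are the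
    two arguments contracted in the coderivative. *)
Lemma cov_kaehler_bilinear (R : realType) (n : nat) (M : manifold R (2 * n))
    (S : su_data M) (D : connection M) (c : chart M) (x b : 'rV[R]_(2 * n)) :
  is_metric (met S) -> is_endo (acs S) -> is_connection D -> cimg c x ->
  bilinear_form (fun u a => cov_tensor D (kaehler S) c x u (pair_arg a b)).
Proof.
move=> mS eS [Dl Dr _ _] cx; have [tg _ _] := mS; have [_ sI _] := eS.
have dw a u := kaehler_derive a b u mS eS cx.
have [wl wr] := kaehler_bilinear mS eS cx.
split=> [a|u] k p q; rewrite !cov_tensor_pair.
  have -> : 'D_(k *: p + q) (fun y => kaehler S c y (pair_arg a b)) x
     = k * 'D_p (fun y => kaehler S c y (pair_arg a b)) x
       + 'D_q (fun y => kaehler S c y (pair_arg a b)) x.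
    have [_ ->] := dw a (k *: p + q); have [_ ->] := dw a p; have [_ ->] := dw a q.
    rewrite mulr_sumr -big_split; apply: eq_bigr => j _ /=.
    have oc := @cimg_open _ _ M c.
    have [_ sg _] := tg.
    rewrite (smooth_derive_linear k p q oc (sI c b j) cx).
    rewrite (smooth_derive_linear k p q oc (sg c _) cx).
    ring.
  rewrite (Dl c x cx k p q a) (Dl c x cx k p q b).
  rewrite (wl b k (D c x p a) (D c x q a)) (wr a k (D c x p b) (D c x q b)).
  ring.
have -> : 'D_u (fun y => kaehler S c y (pair_arg (k *: p + q) b)) x
     = k * 'D_u (fun y => kaehler S c y (pair_arg p b)) x
       + 'D_u (fun y => kaehler S c y (pair_arg q b)) x.
  have [dp _] := dw p u; have [dq _] := dw q u.
  have [_ <-] := is_deriveD (is_deriveZ k (derivableP dp)) (derivableP dq).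
  apply: near_eq_derive; have := open_nbhs_nbhs (conj (@cimg_open _ _ M c) cx).
  apply: filterS => y cy; exact: ((kaehler_bilinear mS eS cy).1 b k p q).
rewrite (Dr c x cx k u p q) (wl (D c x u b) k p q).
rewrite (wl b k (D c x u p) (D c x u q)).
ring.
Qed.

Lemma cov_kaehler_conformal (R : realType) (n : nat) (M : manifold R (2 * n))
    (S : su_data M) (f : M -> R) (D Do : connection M)
    (c : chart M) (x : 'rV[R]_(2 * n)) :
  is_su_structure S -> smooth_function f ->
  levi_civita (met S) D -> levi_civita (met (conformal_change f S)) Do ->
  cimg c x ->
  let g u v := met S c x (pair_arg u v) in
  let I := acs S c x in
  let df u := differential f c x (fun=> u) in
  forall u a b,
  cov_tensor Do (kaehler (conformal_change f S)) c x u (pair_arg a b)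
  = expR (2%:R * f (cinv c x))
    * (cov_tensor D (kaehler S) c x u (pair_arg a b)
       + (- df a * g u (I b) + df (I b) * g u a
          + df b * g u (I a) - df (I a) * g u b)).
Proof.
move=> hS sf hD hDo cx g I df u a b.
have [mS [eS _ _] _ _] := hS.
have h := su_hermitian hS cx.
have HA := levi_civita_conformal mS sf hD hDo cx.
rewrite -(conformal_kaehler_difference h HA).
rewrite -[kaehler (conformal_change f S)]/(rescale (fun p => expR (2%:R * f p)) (kaehler S)).
rewrite !cov_tensor_pair derive_rescale//; last first.
  by have [] := kaehler_derive a b u mS eS cx.
have [wl wr] := kaehler_bilinear mS eS cx.
rewrite /rescale -mulrDr -mulrBr; congr (_ * _).
rewrite -[met S c x (pair_arg (_ - _) _)]kaehlerE -[met S c x (pair_arg a (acs S c x (_ - _)))]kaehlerE.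
rewrite -[met S c x (pair_arg a (acs S c x b))]kaehlerE.
rewrite !(is_scalarD (wl _)) !(is_scalarD (wr _)) !(is_scalarN (wl _)) !(is_scalarN (wr _)).
ring.
Qed.

(** If [eo] is orthonormal for [e^(2f) g] then [e^f eo] is orthonormal for [g];
    by bilinearity the factor [e^(2f)] of the covariant derivative is exactly
    what rescaling both frame arguments costs. *)
Lemma coderivative_conformal (R : realType) (n : nat) (M : manifold R (2 * n))
    (S : su_data M) (f : M -> R) (D Do : connection M) (e eo : frame_choice M)
    (c : chart M) (x : 'rV[R]_(2 * n)) :
  is_su_structure S -> smooth_function f ->
  levi_civita (met S) D -> levi_civita (met (conformal_change f S)) Do ->
  orthonormal_frame (met S) e ->
  orthonormal_frame (met (conformal_change f S)) eo ->
  cimg c x -> forall v,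
  coderivative Do eo (kaehler (conformal_change f S)) c x v
  = coderivative D e (kaehler S) c x v
    - 2%:R * (n%:R - 1) * differential f c x (fun=> acs S c x (v ord0)).
Proof.
move=> hS sf hD hDo he heo cx v; rewrite /coderivative; set b := v ord0.
have [mS [eS _ _] _ _] := hS.
have h := su_hermitian hS cx.
have [Dconn _ _] := hD.
pose g u w := met S c x (pair_arg u w).
pose I := acs S c x.
pose df u := differential f c x (fun=> u).
have sdf : scalar df by exact: differential_scalar.
have [gl gr] := herm_bilin h.
pose Q u a := - df a * g u (I b) + df (I b) * g u a
              + df b * g u (I a) - df (I a) * g u b.
pose B u a := cov_tensor D (kaehler S) c x u (pair_arg a b) + Q u a.
have bilB : bilinear_form B.
  exact: bilinear_formD (cov_kaehler_bilinear b mS eS Dconn cx)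
                        (kaehler_difference_bilinear h sdf b).
pose s := expR (f (cinv c x)).
have ss : expR (2%:R * f (cinv c x)) = s * s.
  by rewrite /s -expRD; congr expR; ring.
pose eo' i := s *: eo c x i.
have heo' : orthonormal g eo'.
  move=> i j; rewrite /eo' /g (is_scalarZ (gl _)) (is_scalarZ (gr _)) mulrA -ss.
  exact: heo.
have he' : orthonormal g (e c x) by move=> i j; exact: he.
have -> : \sum_i cov_tensor Do (kaehler (conformal_change f S)) c x (eo c x i)
                   (pair_arg (eo c x i) b) = \sum_i B (eo' i) (eo' i).
  apply: eq_bigr => i _.
  rewrite (cov_kaehler_conformal hS sf hD hDo cx) ss.
  by rewrite /eo' (is_scalarZ (bilB.1 _)) (is_scalarZ (bilB.2 _)) mulrA.
rewrite (trace_orthonormal (herm_bilin h) (herm_sym h) bilB heo' he') /B.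
rewrite big_split /= (trace_kaehler_difference h sdf he') natrM /df /I.
ring.
Qed.

(** * Conformal change of the W_5 form *)

(** The matrix of the complex coordinates of [upd e i w] in the adapted frame is
    the identity outside column [i], whose diagonal entry is
    [g(e_i, w) + i g(I e_i, w)]. *)
Lemma adapted_psi_im (R : realType) (n : nat) (M : manifold R (2 * n))
    (S : su_data M) (c : chart M) (x : 'rV[R]_(2 * n)) e i w :
  is_su_structure S -> cimg c x -> adapted S c x e ->
  psi_im S c x (upd e i w) = met S c x (pair_arg (acs S c x (e i)) w).
Proof.
move=> hS cx [he heI hII hpsi]; have gC := herm_sym (su_hermitian hS cx).
have := hpsi (upd e i w); rewrite (@det_identity_but_one_col _ _ _ i); last first.
  move=> k l li; rewrite mxE /upd (negbTE li) he [X in (_ +i* X)%C]gC heI.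
  by case: (k == l).
by rewrite mxE /upd eqxx => -[].
Qed.

Lemma adapted_psi_im0 (R : realType) (n : nat) (M : manifold R (2 * n))
    (S : su_data M) (c : chart M) (x : 'rV[R]_(2 * n)) (e : 'I_n -> 'rV[R]_(2 * n)) :
  (0 < n)%N -> is_su_structure S -> cimg c x -> adapted S c x e ->
  psi_im S c x e = 0.
Proof.
move=> n0 hS cx he; have gC := herm_sym (su_hermitian hS cx).
pose i := Ordinal n0.
have <- : upd e i (e i) = e.
  by apply/funext => j; rewrite /upd; case: eqP => // ->.
by rewrite (adapted_psi_im i _ hS cx he) gC; case: he.
Qed.

(** Both structures have the same [I], so the derivatives of [I] in the
    coordinate frame, present in [xi], drop out of the difference. *)
Lemma minimal_connection_conformal (R : realType) (n : nat)
    (M : manifold R (2 * n)) (S : su_data M) (f : M -> R) (D Do : connection M)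
    (eta etao : tensor M 1) (c : chart M) (x : 'rV[R]_(2 * n)) :
  is_su_structure S -> cimg c x ->
  let I := acs S c x in
  let A u v := Do c x u v - D c x u v in
  forall u v,
  minimal_connection (conformal_change f S) Do etao c x u v
  = minimal_connection S D eta c x u v
    + (A u v - 2^-1 *: (A u v + I (A u (I v)))
       + (eta c x (fun=> I u) - etao c x (fun=> I u)) *: I v).
Proof.
move=> hS cx I A u v; have h := su_hermitian hS cx.
have ID a b : I (a + b) = I a + I b.
  by have := herm_lin h 1 a b; rewrite !scale1r.
have I0 : I 0 = 0 by apply: (addrI (I 0)); rewrite -ID !addr0.
have IN a : I (- a) = - I a by apply: (addrI (I a)); rewrite -ID !subrr I0.
have sqI a : I (I a) = - a by exact: herm_sqr h a.
rewrite /minimal_connection /eta_part /xi_part /cov_endo /act_form /= -/I /A.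
rewrite !ID !IN !sqI.
by apply/rowP => j; rewrite !mxE; field.
Qed.

(** The imaginary part of the complex volume form is enough: the conformal
    factor [e^(nf)] only affects the real part of the trace, because [psi_im]
    vanishes on an adapted frame. *)
Lemma W5_conformal (R : realType) (n : nat) (M : manifold R (2 * n))
    (S : su_data M) (f : M -> R) (D Do : connection M) (eta etao : tensor M 1)
    (c : chart M) (x : 'rV[R]_(2 * n)) :
  (0 < n)%N -> is_su_structure S -> smooth_function f ->
  levi_civita (met S) D -> levi_civita (met (conformal_change f S)) Do ->
  is_W5_form S D eta -> is_W5_form (conformal_change f S) Do etao ->
  cimg c x -> forall v : 'rV[R]_(2 * n),
  etao c x (fun=> v) = eta c x (fun=> v) - n%:R^-1 * differential f c x (fun=> v).
Proof.
move=> n0 hS sf hD hDo [_ [_ _ _ par]] [_ [_ _ _ paro]] cx v.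
have [mS _ [_ tpsi] /(_ c x cx) [U [e0 [_ Ux _ _ /(_ x Ux)]]]] := hS.
set e := fun i => e0 i x => he.
have h := su_hermitian hS cx; have [gl gr] := herm_bilin h.
pose g u w := met S c x (pair_arg u w).
pose I := acs S c x.
pose df u := differential f c x (fun=> u).
have sdf : scalar df by exact: differential_scalar.
have HA := levi_civita_conformal mS sf hD hDo cx.
(* The trace formula gives the value of the forms at [I u]. *)
pose u := I (I (I v)).
have Iu : I u = v by rewrite /u /I !(herm_sqr h) opprK.
pose B k := minimal_connection S D eta c x u (e k).
pose Bo k := minimal_connection (conformal_change f S) Do etao c x u (e k).
have trB : 'D_u (fun y => psi_im S c y e) x = \sum_k g (I (e k)) (B k).
  have := par c x cx u e; rewrite /cov_tensor => /eqP; rewrite subr_eq0 => /eqP ->.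
  by apply: eq_bigr => k _; rewrite (adapted_psi_im k _ hS cx he).
have trBo : 'D_u (fun y => psi_im S c y e) x = \sum_k g (I (e k)) (Bo k).
  have := paro c x cx u e; rewrite /cov_tensor.
  rewrite [X in X - _ = _ -> _]derive_rescale//; last exact: tensor_derivable.
  rewrite (adapted_psi_im0 n0 hS cx he) mulr0 add0r /rescale -mulr_sumr -mulrBr => /eqP.
  rewrite mulf_eq0 gt_eqF ?expR_gt0 //= subr_eq0 => /eqP ->.
  by apply: eq_bigr => k _; rewrite (adapted_psi_im k _ hS cx he).
have [he1 heI hII _] := he.
have Ie := unitary_contorsion_trace h sdf HA he1 heI u.
have : \sum_k g (I (e k)) (Bo k) = \sum_k g (I (e k)) (B k)
         + (- df v + n%:R * (eta c x (fun=> v) - etao c x (fun=> v))).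
  rewrite -{1}Iu -Ie.
  have -> : n%:R * (eta c x (fun=> v) - etao c x (fun=> v))
     = \sum_(k < n) (eta c x (fun=> v) - etao c x (fun=> v)) * g (I (e k)) (I (e k)).
    under eq_bigr do rewrite /g /I hII eqxx mulr1.
    by rewrite sumr_const card_ord mulr_natl.
  rewrite -!big_split; apply: eq_bigr => k _ /=.
  rewrite /Bo (minimal_connection_conformal f D Do eta etao hS cx) -/I Iu.
  by rewrite /g /I !(is_scalarD (gr _)) (is_scalarZ (gr _) (_ - _)).
rewrite -trB -trBo => E.
have nN0 : n%:R != 0 :> R by rewrite pnatr_eq0 -lt0n.
have {E} E : n%:R * (eta c x (fun=> v) - etao c x (fun=> v)) = df v by lra.
rewrite -/(df v) -E mulrA mulVf// mul1r; ring.
Qed.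

(** * The W_4 and W_5 parts under a conformal change *)

Theorem proposition2p12 (R : realType) (n : nat) (hn : (2 <= n)%N)
    (M : manifold R (2 * n)) (S : su_data M) (hS : is_su_structure S)
    (f : M -> R) (hf : smooth_function f)
    (D Do : connection M)
    (hD : levi_civita (met S) D)
    (hDo : levi_civita (met (conformal_change f S)) Do)
    (e eo : frame_choice M)
    (he : orthonormal_frame (met S) e)
    (heo : orthonormal_frame (met (conformal_change f S)) eo)
    (eta etao : tensor M 1)
    (heta : is_W5_form S D eta)
    (hetao : is_W5_form (conformal_change f S) Do etao) :
  let Idw := act_form (acs S) (coderivative D e (kaehler S)) in
  let Idwo := act_form (acs (conformal_change f S))
                (coderivative Do eo (kaehler (conformal_change f S))) in
  forall (c : chart M) (x : 'rV[R]_(2 * n)), cimg c x ->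
  forall v : 'I_1 -> 'rV[R]_(2 * n),
    [/\ Idwo c x v = Idw c x v - 2%:R * (n%:R - 1) * differential f c x v,
        etao c x v = eta c x v - n%:R^-1 * differential f c x v
      & 2%:R * n%:R * (n%:R - 1) * etao c x v - Idwo c x v
        = 2%:R * n%:R * (n%:R - 1) * eta c x v - Idw c x v].
Proof.
move=> Idw Idwo c x cx v.
have n0 : (0 < n)%N by exact: leq_trans hn.
have -> : v = fun=> v ord0 by apply/funext => i; rewrite ord1.
have h := su_hermitian hS cx.
have sdf := differential_scalar hf cx.
have W4 : Idwo c x (fun=> v ord0)
    = Idw c x (fun=> v ord0)
      - 2%:R * (n%:R - 1) * differential f c x (fun=> v ord0).
  rewrite /Idwo /Idw /act_form /= (coderivative_conformal hS hf hD hDo he heo cx) /=.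
  rewrite (herm_sqr h) (is_scalarN sdf); ring.
have W5 := W5_conformal n0 hS hf hD hDo heta hetao cx (v ord0).
split=> //; rewrite W4 W5.
have nN0 : n%:R != 0 :> R by rewrite pnatr_eq0 -lt0n.
by field.
Qed.
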